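(* Let $V$ be a vector space equipped with a linear map $$Y(\cdot,x):V\to\mathrm{Hom}(V,V((x)))\subset(\mathrm{End}\,V)[[x,x^{-1}]],\qquad v\mapsto Y(v,x)=\sum_{n\in\mathbb{Z}}v_nx^{-n-1},$$ and let $U$ be a subset of $V$. Assume that all the following conditions are satisfied: (i) for $u,v\in U$, there exists a nonnegative integer $k$ such that $$(x_1-x_2)^kY(u,x_1)Y(v,x_2)=(x_1-x_2)^kY(v,x_2)Y(u,x_1);$$ (ii) $V$ is linearly spanned by the vectors $u^{(1)}_{m_1}\cdots u^{(r)}_{m_r}u$ for $u^{(1)},\dots,u^{(r)},u\in U$, $m_1,\dots,m_r\in\mathbb{Z}$, with $r\in\mathbb{N}$; (iii) for all $u\in U$, $v\in V$, $$Y(Y(u,x_0)v,x_2)=\mathrm{Res}_{x_1}\left(x_0^{-1}\delta\left(\frac{x_1-x_2}{x_0}\right)Y(u,x_1)Y(v,x_2)-x_0^{-1}\delta\left(\frac{x_2-x_1}{-x_0}\right)Y(v,x_2)Y(u,x_1)\right).$$ Then $(V,Y)$ carries the structure of a vertex Leibniz algebra.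
   Context: All vector spaces are over $\mathbb{C}$; $\mathbb{N}$ is the set of nonnegative integers. $V((x))$ denotes the space of lower truncated formal Laurent series, $\delta(x)=\sum_{n\in\mathbb{Z}}x^n$, powers $(x\pm y)^n$ are expanded in nonnegative integer powers of the second variable $y$, and $\mathrm{Res}_{x_1}$ denotes the coefficient of $x_1^{-1}$. A vertex Leibniz algebra is a vector space $V$ with a linear map $Y(\cdot,x):V\to\mathrm{Hom}(V,V((x)))$ such that for all $u,v\in V$ the Jacobi identity holds: $$x_0^{-1}\delta\left(\tfrac{x_1-x_2}{x_0}\right)Y(u,x_1)Y(v,x_2)-x_0^{-1}\delta\left(\tfrac{x_2-x_1}{-x_0}\right)Y(v,x_2)Y(u,x_1)=x_2^{-1}\delta\left(\tfrac{x_1-x_0}{x_2}\right)Y(Y(u,x_0)v,x_2).$$ *)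

(* Defs.v *)
From HB Require Import structures.
From mathcomp Require Import all_boot all_order all_algebra.
From mathcomp Require Import boolp classical_sets functions cardinality fsbigop.
From mathcomp Require Import reals.
From mathcomp Require Export complex.

Set Implicit Arguments.
Unset Strict Implicit.
Unset Printing Implicit Defensive.

Import Order.TTheory GRing.Theory Num.Theory.

Local Open Scope classical_set_scope.
Local Open Scope ring_scope.

(** Doubly infinite formal series W[[x0^±1, x1^±1, x2^±1]].  The monomial
    x0^a x1^b x2^c is encoded by its exponent vector (a, b, c), and a series by
    its coefficient function.  A series in which a variable does not occur is
    supported on the monomials where the exponent of that variable is 0. *)

Definition monom : Type := (int * int * int)%type.

Definition fseries (W : Type) : Type := monom -> W.

Definition x0 : monom := (1, 0, 0).
Definition x1 : monom := (0, 1, 0).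
Definition x2 : monom := (0, 0, 1).

Definition fsub (W : zmodType) (f g : fseries W) : fseries W :=
  fun p => f p - g p.

(** Each sum below ranges over an infinite index set and denotes the finite sum
    of its nonzero terms.  Its value would be 0 if infinitely many terms were
    nonzero, but this never happens in [vertex_Leibniz] or in the conditions on
    a state-field map below: those series are all applied to a vector of V, and
    the truncation axiom makes each coefficient a finite sum. *)

Definition fmul (K : numFieldType) (W : lmodType K)
    (f : fseries K) (g : fseries W) : fseries W :=
  fun p => \sum_(q \in [set: monom]) f q *: g (p - q).

Definition gbinom (K : numFieldType) (n : int) (j : nat) : K :=
  (\prod_(i < j) (n - i%:Z)%:~R) / (j`!)%:R.

(** (x - y)^n = sum_(j >= 0) (-1)^j binom(n, j) x^(n-j) y^j *)
Definition powB (K : numFieldType) (x y : monom) (n : int) : fseries K :=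
  fun p => \sum_(j \in [set: nat])
    (if p == x *~ (n - j%:Z) + y *~ j%:Z then (-1) ^+ j * gbinom K n j else 0).

(** z^-1 delta((x - y) / (s z)) = sum_(n in Z) s^(-n) z^(-n-1) (x - y)^n,
    for a sign s; the coefficient of p in z^(-n-1) f is that of z^(n+1) p
    in f. *)
Definition deltaB (K : numFieldType) (s : K) (z x y : monom) : fseries K :=
  fun p => \sum_(n \in [set: int]) s ^ (- n) * powB K x y n (p + z *~ (n + 1)).

Definition Res_x1 (W : zmodType) (f : fseries W) : fseries W :=
  fun p => let: (a, b, c) := p in if b == 0 then f (a, -1, c) else 0.

(** [Y u n v] is u_n v, the coefficient of x^(-n-1) in Y(u, x) v.  The three
    conditions say that Y(u, x) v lies in V((x)) and is linear in u and in v,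
    i.e. that Y is a linear map V -> Hom(V, V((x))). *)
Record state_field (K : numFieldType) (V : lmodType K)
    (Y : V -> int -> V -> V) : Prop := StateField {
  state_field_linearl : forall (n : int) (w : V), linear (fun u => Y u n w);
  state_field_linearr : forall (u : V) (n : int), linear (Y u n);
  state_field_trunc : forall u w : V,
    exists N : int, forall n : int, N <= n -> Y u n w = 0 }.

(** Y(u, x1) Y(v, x2) w *)
Definition Y1Y2 (K : numFieldType) (V : lmodType K)
    (Y : V -> int -> V -> V) (u v w : V) : fseries V :=
  fun p => let: (a, b, c) := p in
    if a == 0 then Y u (- b - 1) (Y v (- c - 1) w) else 0.

(** Y(v, x2) Y(u, x1) w *)
Definition Y2Y1 (K : numFieldType) (V : lmodType K)
    (Y : V -> int -> V -> V) (v u w : V) : fseries V :=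
  fun p => let: (a, b, c) := p in
    if a == 0 then Y v (- c - 1) (Y u (- b - 1) w) else 0.

(** Y(Y(u, x0) v, x2) w *)
Definition YY02 (K : numFieldType) (V : lmodType K)
    (Y : V -> int -> V -> V) (u v w : V) : fseries V :=
  fun p => let: (a, b, c) := p in
    if b == 0 then Y (Y u (- a - 1) v) (- c - 1) w else 0.

(** x0^-1 delta((x1 - x2) / x0) Y(u, x1) Y(v, x2) w
    - x0^-1 delta((x2 - x1) / (- x0)) Y(v, x2) Y(u, x1) w *)
Definition Jacobi_lhs (K : numFieldType) (V : lmodType K)
    (Y : V -> int -> V -> V) (u v w : V) : fseries V :=
  fsub (fmul (deltaB 1 x0 x1 x2) (Y1Y2 Y u v w))
       (fmul (deltaB (-1) x0 x2 x1) (Y2Y1 Y v u w)).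

(** x2^-1 delta((x1 - x0) / x2) Y(Y(u, x0) v, x2) w *)
Definition Jacobi_rhs (K : numFieldType) (V : lmodType K)
    (Y : V -> int -> V -> V) (u v w : V) : fseries V :=
  fmul (deltaB 1 x2 x1 x0) (YY02 Y u v w).

Record vertex_Leibniz (K : numFieldType) (V : lmodType K)
    (Y : V -> int -> V -> V) : Prop := VertexLeibniz {
  vertex_Leibniz_state_field : state_field Y;
  vertex_Leibniz_Jacobi : forall u v w : V,
    Jacobi_lhs Y u v w =1 Jacobi_rhs Y u v w }.

Definition mutually_local (K : numFieldType) (V : lmodType K)
    (Y : V -> int -> V -> V) (u v : V) : Prop :=
  exists k : nat, forall w : V,
    fmul (powB K x1 x2 k%:Z) (Y1Y2 Y u v w)
    =1 fmul (powB K x1 x2 k%:Z) (Y2Y1 Y v u w).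

(** The vectors u1_(m1) ... ur_(mr) u with u1, ..., ur, u in U and r >= 0. *)
Inductive mode_word (K : numFieldType) (V : lmodType K)
    (Y : V -> int -> V -> V) (U : set V) : V -> Prop :=
| mode_word0 (u : V) : U u -> mode_word Y U u
| mode_wordS (u : V) (m : int) (v : V) :
    U u -> mode_word Y U v -> mode_word Y U (Y u m v).

Definition spans (K : numFieldType) (V : lmodType K) (S : set V) : Prop :=
  forall v : V, exists (n : nat) (c : 'I_n -> K) (s : 'I_n -> V),
    (forall i, S (s i)) /\ v = \sum_(i < n) c i *: s i.

(* Main.v *)
Require Import Defs.
From mathcomp Require Import all_boot all_order all_algebra.
From mathcomp Require Import boolp classical_sets functions cardinality fsbigop
  reals.
From mathcomp Require Import zify ring.

(** In terms of modes, the Jacobi identity for (u, v) is a family of identities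
    mode12 - mode21 = iter_mode indexed by (l, m, n), whose three terms all satisfy
    F (l + 1) m n = F l (m + 1) n - F l m (n + 1).  A solution of this recurrence
    that vanishes for large l and for large m, or for large l and for m = 0, is
    zero.  Hence Jacobi is equivalent to locality (mode12 =
      mode21 for large l) together
    with weak associativity (mode12 =
      iter_mode for large m), and also to locality together
    with the iterate formula (the case m = 0).

    Dong's trick: if D (q + 1) = A (D q) - B (D q) with commuting A and B, D q = 0
    for large q, and A^M B^M kills every D q, then D q is killed by a power of B.
    With A = S1 - S3 and B = S2 - S3, for S_i the shift in the i-th mode, this
    gives locality of (a_r b, v) from the locality of the three pairs.  With
    A = S1 + S3 and B = S2 + S3, it gives weak associativity of (a_r b, v) from
    the Jacobi identities for (a, -) and (b, -).  So Jacobi first holds for u in U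
    and arbitrary v, by locality and (iii), and then propagates to words u. *)

Set Implicit Arguments.
Unset Strict Implicit.
Unset Printing Implicit Defensive.

Import Order.TTheory GRing.Theory Num.Theory.
Local Open Scope ring_scope.
Local Open Scope complex_scope.

(** * Finitely supported sums over infinite index types *)

Lemma fsbig_finite_nat (W : nmodType) (g : nat -> W) (N : nat) :
  (forall i, (N <= i)%N -> g i = 0) ->
  \sum_(i \in [set: nat]) g i = \sum_(i < N) g i.
Proof.
move=> g0; rewrite fsbig_ord; apply/esym/fsbig_widen => // i [_ /= /negP].
by rewrite -leqNgt => /g0.
Qed.

Lemma fsbig_single (W : nmodType) (T : choiceType) (g : T -> W) (j : T) :
  (forall i, i != j -> g i = 0) -> \sum_(i \in [set: T]) g i = g j.
Proof.
move=> g0; rewrite -(fsbig_widen [set j]%classic) ?fsbig_set1// => i [_ /= /eqP].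
exact: g0.
Qed.

Lemma fsbig_zero (W : nmodType) (T : choiceType) (g : T -> W) :
  (forall i, g i = 0) -> \sum_(i \in [set: T]) g i = 0.
Proof. by move=> g0; rewrite fsbig1. Qed.

(** * Binomial sums *)

Lemma gbinom_pascal (K : numFieldType) (q : int) (i : nat) :
  gbinom K (q + 1) i.+1 = gbinom K q i.+1 + gbinom K q i.
Proof.
rewrite /gbinom big_ord_recl [X in _ = X / _ + _]big_ord_recr /=.
under eq_bigr do rewrite /bump /= add1n.
rewrite (eq_bigr (fun j : 'I_i => (q - j%:Z)%:~R)); last first.
  by move=> j _; congr (_%:~R); lia.
set p := \prod_(j < i) _.
have -> : (i.+1)`!%:R = (i%:R + 1) * (i`!)%:R :> K.
  by rewrite factS natrM -natr1.
have h1 : (i`!)%:R != 0 :> K by rewrite pnatr_eq0 -lt0n fact_gt0.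
have h2 : i%:R + 1 != 0 :> K by rewrite natr1 pnatr_eq0.
rewrite !(intrD, intrB, rmorphB) /=.
by field; rewrite h1 h2.
Qed.

Lemma gbinomn0 (K : numFieldType) (q : int) : gbinom K q 0 = 1.
Proof. by rewrite /gbinom big_ord0 fact0 divr1. Qed.

Lemma gbinom0S (K : numFieldType) (i : nat) : gbinom K 0 i.+1 = 0.
Proof. by rewrite /gbinom big_ord_recl subr0 !mul0r. Qed.

(** Upper negation: reversing the product matches the factors up to sign. [Jacobi_0E] uses it to
    trade powers of x1 - x0 for powers of x2 + x0. *)
Lemma gbinom_neg (K : numFieldType) (m : int) (j : nat) :
  (-1) ^+ j * gbinom K (j%:Z - 1 - m) j = gbinom K m j.
Proof.
rewrite /gbinom mulrA; congr (_ / _).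
rewrite -[in X in X * _](card_ord j) -prodr_const -big_split /=.
rewrite (reindex_inj rev_ord_inj); apply: eq_bigr => i _ /=.
by rewrite mulN1r -rmorphN; congr (_%:~R); have := ltn_ord i; lia.
Qed.

Section BinomialSum.
Context {K : numFieldType} {V : lmodType K}.
Implicit Types g h : nat -> V.

Definition eventually0 g : Prop := exists N, forall i, (N <= i)%N -> g i = 0.

(** This is ((1 - S)^q g)(0) for the shift S, the way the coefficients of (x - y)^q act on modes. An
    infinite support would give the default value 0, whence the [eventually0] conditions below. *)
Definition bsum (q : int) (g : nat -> V) : V :=
  \sum_(i \in [set: nat]) ((-1) ^+ i * gbinom K q i) *: g i.

Lemma bsumE N q g : (forall i, (N <= i)%N -> g i = 0) ->
  bsum q g = \sum_(i < N) ((-1) ^+ i * gbinom K q i) *: g i.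
Proof.
by move=> g0; apply: fsbig_finite_nat => i /g0 ->; rewrite scaler0.
Qed.

Lemma eq_bsum q g h : g =1 h -> bsum q g = bsum q h.
Proof. by move=> /funext ->. Qed.

Lemma bsum_zero q g : (forall i, g i = 0) -> bsum q g = 0.
Proof. by move=> g0; apply: fsbig_zero => i; rewrite g0 scaler0. Qed.

Lemma bsum0 g : bsum 0 g = g 0%N.
Proof.
rewrite /bsum (@fsbig_single _ _ _ 0%N); first by rewrite gbinomn0 mulr1 scale1r.
by case=> // i _; rewrite gbinom0S mulr0 scale0r.
Qed.

Lemma bsum_pascal q g : eventually0 g ->
  bsum (q + 1) g = bsum q g - bsum q (fun i => g i.+1).
Proof.
move=> [N g0]; rewrite !(@bsumE N.+1) => [|i iN|i iN|i iN]; try by apply: g0; lia.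
rewrite [X in _ - X]big_ord_recr /= g0// scaler0 addr0.
rewrite !big_ord_recl !gbinomn0 -addrA; congr (_ + _).
rewrite -sumrB; apply: eq_bigr => i _ /=.
rewrite /bump /= add1n gbinom_pascal mulrDr scalerDl exprS; congr (_ + _).
by rewrite -scaleNr; congr (_ *: _); ring.
Qed.

Lemma bsum_lin q c g h : eventually0 g -> eventually0 h ->
  bsum q (fun i => c *: g i + h i) = c *: bsum q g + bsum q h.
Proof.
move=> [N g0] [N' h0]; rewrite !(@bsumE (maxn N N')).
- rewrite scaler_sumr -big_split; apply: eq_bigr => i _ /=.
  by rewrite scalerDr !scalerA; congr (_ *: _ + _); ring.
- by move=> i; rewrite geq_max => /andP[_ /h0].
- by move=> i; rewrite geq_max => /andP[/g0].
- by move=> i; rewrite geq_max => /andP[/g0 -> /h0 ->]; rewrite scaler0 addr0.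
Qed.

Lemma bsumB q g h : eventually0 g -> eventually0 h ->
  bsum q (fun i => g i - h i) = bsum q g - bsum q h.
Proof.
move=> g0 h0; rewrite -scaleN1r addrC -bsum_lin//.
by apply: eq_bsum => i; rewrite scaleN1r addrC.
Qed.

Lemma bsumN q g : eventually0 g -> bsum q (fun i => - g i) = - bsum q g.
Proof.
move=> g0; rewrite -[RHS]sub0r -[X in X - _](bsum_zero q (fun=> erefl)).
by rewrite -bsumB; [apply: eq_bsum => i; rewrite sub0r|exists 0%N|].
Qed.

Lemma bsumD q g h : eventually0 g -> eventually0 h ->
  bsum q (fun i => g i + h i) = bsum q g + bsum q h.
Proof.
move=> g0 h0; rewrite -[bsum q g]scale1r -bsum_lin//.
by apply: eq_bsum => i; rewrite scale1r.
Qed.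

Lemma linear_bsum (f : V -> V) q g : linear f -> eventually0 g ->
  f (bsum q g) = bsum q (fun i => f (g i)).
Proof.
move=> fl [N g0].
have f0 : f 0 = 0 by have := fl (-1) 0 0; rewrite scaler0 addr0 scaleN1r addNr.
have fD x y : f (x + y) = f x + f y by have := fl 1 x y; rewrite !scale1r.
have fZ c x : f (c *: x) = c *: f x by have := fl c x 0; rewrite !addr0 f0 addr0.
rewrite !(@bsumE N) => [|i /g0 ->|//]; last exact: f0.
by rewrite (big_morph f fD f0); apply: eq_bigr => i _; rewrite fZ.
Qed.

End BinomialSum.

(** * Recurrences and shift operators *)

Section ThreeTermRecurrence.
Context {W : zmodType}.
Implicit Types F G : int -> int -> int -> W.

(** With F l m n the coefficient of x0^(-l-1) x1^(-m-1) x2^(-n-1), this says x0 F = (x1 - x2) F. *)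
Definition rec3 F : Prop :=
  forall l m n, F (l + 1) m n = F l (m + 1) n - F l m (n + 1).

Lemma rec3B F G : rec3 F -> rec3 G -> rec3 (fun l m n => F l m n - G l m n).
Proof. by move=> rF rG l m n; rewrite rF rG opprD addrACA -opprD. Qed.

(** Solved for its last term, the recurrence gives F l m n from F l (m + 1) (n - 1) and F (l + 1) m
    (n - 1). Induct on the distance of m to M, and inside it on that of l to L. *)
Lemma rec3_eq0_lm F (L M : int) : rec3 F ->
  (forall l m n, L <= l -> F l m n = 0) ->
  (forall l m n, M <= m -> F l m n = 0) ->
  forall l m n, F l m n = 0.
Proof.
move=> rF FL FM.
suff FMd d l m n : M <= m + d%:Z -> F l m n = 0.
  by move=> l m n; apply: (FMd `|M - m|%N); lia.
elim: d l m n => [|d IH] l m n Mm; first by apply: FM; lia.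
have [j jL] : exists j : nat, L <= l + j%:Z by exists `|L - l|%N; lia.
elim: j l n jL => [|j IHj] l n jL; first by apply: FL; lia.
have := rF l m (n - 1); rewrite subrK IHj ?[F l (m + 1) _]IH; try lia.
by rewrite sub0r => /esym/eqP; rewrite oppr_eq0 => /eqP.
Qed.

Lemma rec3_eq0_l0 F (L : int) : rec3 F ->
  (forall l m n, L <= l -> F l m n = 0) ->
  (forall l n, F l 0 n = 0) ->
  forall l m n, F l m n = 0.
Proof.
move=> rF FL F0; apply: (rec3_eq0_lm rF FL (M := 0)) => l m n m0.
have [j ->] : exists j : nat, m = j%:Z by exists `|m|%N; lia.
elim: j l n {m m0} => // j IH l n.
by have := rF l j%:Z n; rewrite !IH subr0 -addn1 PoszD => /esym.
Qed.

(** The recurrence carries the slice l = 0 to all l >= 0. For l < 0 it expresses F l m n through the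
    slice l + 1 and F l (m - 1) (n + 1), and the vanishing for large n ends the descent. *)
Lemma rec3_eq0_n F (N : int) : rec3 F ->
  (forall m n, F 0 m n = 0) ->
  (forall l m n, N <= n -> F l m n = 0) ->
  forall l m n, F l m n = 0.
Proof.
move=> rF F0 FN.
have Fpos (j : nat) m n : F j%:Z m n = 0.
  by elim: j m n => // j IH m n; rewrite -addn1 PoszD rF !IH subr0.
suff Fneg : forall (j : nat) m n, F (- j%:Z) m n = 0.
  by case=> j m n; rewrite ?NegzE ?Fneg ?Fpos.
elim=> [|j IH] m n; first exact: F0.
have [i iN] : exists i : nat, N <= n + i%:Z by exists `|N - n|%N; lia.
elim: i m n iN => [|i IHi] m n iN; first by apply: FN; lia.
have := rF (- j.+1%:Z) (m - 1) n.
have -> : - j.+1%:Z + 1 = - j%:Z by lia.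
rewrite IH subrK (IHi _ (n + 1)); last by lia.
by rewrite subr0.
Qed.

End ThreeTermRecurrence.

Section BinomialOperator.
Context {K : pzRingType} {V : lmodType K} {I : Type}.
Implicit Types (f g : I -> V) (s : K).

(* (S_al + s S_be) f, where S_al is the shift f |-> f o al. *)
Definition dop s (al be : I -> I) f : I -> V :=
  fun x => f (al x) + s *: f (be x).

Lemma dopB s al be f g :
  dop s al be (fun x => f x - g x) = fun x => dop s al be f x - dop s al be g x.
Proof.
by apply/funext => x; rewrite /dop scalerBr addrACA -opprD.
Qed.

Lemma dop0 s al be : dop s al be (fun=> 0) = fun=> 0.
Proof. by apply/funext => x; rewrite /dop scaler0 addr0. Qed.

Lemma iter_dopB k s al be f g : iter k (dop s al be) (fun x => f x - g x) =
  fun x => iter k (dop s al be) f x - iter k (dop s al be) g x.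
Proof. by elim: k => //= k ->; rewrite dopB. Qed.

Lemma iter_dopD k s al be f g : iter k (dop s al be) (fun x => f x + g x) =
  fun x => iter k (dop s al be) f x + iter k (dop s al be) g x.
Proof.
elim: k => //= k ->; apply/funext => x.
by rewrite /dop scalerDr addrACA.
Qed.

Lemma iter_dop0 k s al be : iter k (dop s al be) (fun=> 0) = fun=> 0.
Proof. by elim: k => //= k ->; rewrite dop0. Qed.

Lemma iter_dop_eq0 k k' s al be f : (k <= k')%N ->
  iter k (dop s al be) f = (fun=> 0) -> iter k' (dop s al be) f = fun=> 0.
Proof. by move=> /subnK <- h; rewrite iterD h iter_dop0. Qed.

Lemma iter_dop_linear k s al be (h : V -> V) f : linear h ->
  iter k (dop s al be) (fun x => h (f x)) = fun x => h (iter k (dop s al be) f x).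
Proof.
by move=> hl; elim: k => //= k ->; apply/funext => x;
  rewrite /dop [in RHS]addrC hl addrC.
Qed.

Lemma dopC s t al be ga de f :
  (forall x, al (ga x) = ga (al x)) -> (forall x, al (de x) = de (al x)) ->
  (forall x, be (ga x) = ga (be x)) -> (forall x, be (de x) = de (be x)) ->
  GRing.comm s t ->
  dop s al be (dop t ga de f) = dop t ga de (dop s al be f).
Proof.
move=> ag ad bg bd st; apply/funext => x; rewrite /dop !scalerDr !scalerA st.
by rewrite ag ad bg bd addrACA.
Qed.

Lemma iter_comm (T : Type) (f g : T -> T) k x :
  (forall x, f (g x) = g (f x)) -> f (iter k g x) = iter k g (f x).
Proof. by move=> fg; elim: k => //= k IH; rewrite fg IH. Qed.

End BinomialOperator.

(** Freezing a mode: [phi] embeds a smaller index set compatibly with the shifts, so identities for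
    pairs of modes transfer to slices of families indexed by triples, and back. *)
Lemma iter_dop_slice {K : pzRingType} {V : lmodType K} {I J : Type}
    (phi : J -> I) (al be : I -> I) (al' be' : J -> J) k s (f : I -> V) y :
  (forall y, phi (al' y) = al (phi y)) -> (forall y, phi (be' y) = be (phi y)) ->
  iter k (dop s al be) f (phi y) = iter k (dop s al' be') (fun y => f (phi y)) y.
Proof.
by move=> pa pb; elim: k y => //= k IH y; rewrite {1}/dop -pa -pb !IH.
Qed.

(** * Dong's trick in abstract form *)

Section Kill.
Context {K : comPzRingType} {V : lmodType K} {I : Type}.
Variables (s : K) (shift1 shift2 shift3 : I -> I).
Hypotheses (s12 : forall x, shift1 (shift2 x) = shift2 (shift1 x))
           (s13 : forall x, shift1 (shift3 x) = shift3 (shift1 x))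
           (s23 : forall x, shift2 (shift3 x) = shift3 (shift2 x)).

Let A : (I -> V) -> I -> V := dop s shift1 shift3.
Let B : (I -> V) -> I -> V := dop s shift2 shift3.

Lemma dop_pairC f : A (B f) = B (A f).
Proof. by apply: dopC => //; exact: mulrC. Qed.

(** Since A - B = [shift1] - [shift2] as operators, B (D q) = A (D q) - D (q + 1). Once B^t kills D
    (q + 1), every further B applied to B^t (D q) can be replaced by A. After M of them A^M B^M
    appears, because t >= M. *)
Lemma Dong_kill (D : int -> I -> V) (N : int) (M : nat) :
  (forall q x, D (q + 1) x = D q (shift1 x) - D q (shift2 x)) ->
  (forall q x, N <= q -> D q x = 0) ->
  (forall q, iter M A (iter M B (D q)) = fun=> 0) ->
  forall d q, N <= q + d%:Z -> iter (M + M * d) B (D q) = fun=> 0.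
Proof.
move=> rD DN DM; elim=> [|d IH] q Nq.
  have -> : D q = fun=> 0 by apply/funext => x; apply: DN; lia.
  by rewrite iter_dop0.
set t := (M + M * d)%N.
have Bt1 : iter t B (D (q + 1)) = fun=> 0 by apply: IH; lia.
have BD : B (D q) = fun x => A (D q) x - D (q + 1) x.
  by apply/funext => x; rewrite /A /B /dop rD; rewrite opprB [RHS]addrC addrA subrK.
have step j : iter (t + j) B (D q) = iter j A (iter t B (D q)).
  elim: j => [|j IHj]; first by rewrite addn0.
  have Btj : iter (t + j) B (D (q + 1)) = fun=> 0.
    by apply: iter_dop_eq0 Bt1; exact: leq_addr.
  rewrite addnS iterSr BD iterS -IHj (iter_comm _ _ dop_pairC).
  rewrite (iter_dopB (t + j) s shift2 shift3 (A (D q)) (D (q + 1))) -/B Btj.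
  by apply/funext => x; rewrite subr0.
have -> : (M + M * d.+1 = t + M)%N by rewrite /t; lia.
rewrite step /t addnC iterD.
have AB k f : iter k A (iter (M * d) B f) = iter (M * d) B (iter k A f).
  by elim: k => //= k ->; apply: iter_comm; exact: dop_pairC.
by rewrite AB DM iter_dop0.
Qed.

End Kill.

(** * Modes of the three terms of the Jacobi identity *)

Definition pshift1 (x : int * int) : int * int := (x.1 + 1, x.2).
Definition pshift2 (x : int * int) : int * int := (x.1, x.2 + 1).

Section Rec3Iter.
Context {K : pzRingType} {V : lmodType K}.
Variables (F : int -> int -> int -> V) (rF : rec3 F).

(** Iterates x0 = x1 - x2 from l = 0. The next lemma iterates x1 = x0 + x2 from m = 0; there
    [pshift1] moves l and [pshift2] moves n. *)
Lemma rec3_iter_l (k : nat) x :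
  F k x.1 x.2 = iter k (dop (-1) pshift1 pshift2) (fun x => F 0 x.1 x.2) x.
Proof.
elim: k x => //= k IH x.
by rewrite -addn1 PoszD rF /dop -!IH scaleN1r.
Qed.

Lemma rec3_iter_m (k : nat) x :
  F x.1 k x.2 = iter k (dop 1 pshift1 pshift2) (fun x => F x.1 0 x.2) x.
Proof.
elim: k x => //= k IH x.
by rewrite -addn1 PoszD /dop -!IH scale1r /= rF subrK.
Qed.

End Rec3Iter.

Lemma rec3_iter_l_ge {K : pzRingType} {V : lmodType K}
    (F : int -> int -> int -> V) (k : nat) : rec3 F ->
  iter k (dop (-1) pshift1 pshift2) (fun x => F 0 x.1 x.2) = (fun=> 0) ->
  forall l m n, k%:Z <= l -> F l m n = 0.
Proof.
move=> rF Fk l m n kl.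
have -> : l = `|l|%N by lia.
rewrite (rec3_iter_l rF _ (m, n)) (iter_dop_eq0 _ Fk)//; lia.
Qed.

Lemma rec3_iter_m_ge {K : pzRingType} {V : lmodType K}
    (F : int -> int -> int -> V) (k : nat) : rec3 F ->
  iter k (dop 1 pshift1 pshift2) (fun x => F x.1 0 x.2) = (fun=> 0) ->
  forall l m n, k%:Z <= m -> F l m n = 0.
Proof.
move=> rF Fk l m n kl.
have -> : m = `|m|%N by lia.
rewrite (rec3_iter_m rF _ (l, n)) (iter_dop_eq0 _ Fk)//; lia.
Qed.

Section Borcherds.
Context {K : numFieldType} {V : lmodType K}.
Variables (Y : V -> int -> V -> V) (hY : state_field Y).
Implicit Types (u v w z : V) (l m n q : int) (k : nat).

Lemma mode0l n w : Y 0 n w = 0.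
Proof.
by have := state_field_linearl hY n w (-1) 0 0;
  rewrite scaler0 addr0 scaleN1r addNr.
Qed.

Lemma mode0r u n : Y u n 0 = 0.
Proof.
by have := state_field_linearr hY u n (-1) 0 0;
  rewrite scaler0 addr0 scaleN1r addNr.
Qed.

Lemma modeBl u v n w : Y (u - v) n w = Y u n w - Y v n w.
Proof.
by rewrite addrC -scaleN1r (state_field_linearl hY n w) scaleN1r addrC.
Qed.

Lemma modeBr u n v w : Y u n (v - w) = Y u n v - Y u n w.
Proof.
by rewrite addrC -scaleN1r (state_field_linearr hY u n) scaleN1r addrC.
Qed.

Lemma modeZl c u n w : Y (c *: u) n w = c *: Y u n w.
Proof.
by have := state_field_linearl hY n w c u 0; rewrite !addr0 mode0l addr0.
Qed.

Lemma modeZr c u n w : Y u n (c *: w) = c *: Y u n w.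
Proof.
by have := state_field_linearr hY u n c w 0; rewrite !addr0 mode0r addr0.
Qed.

(* [mode12], [mode21] and [iter_mode] are the coefficients of
   x0^(-l-1) x1^(-m-1) x2^(-n-1) in the three terms of the Jacobi identity. *)
Definition mode12 u v w l m n : V :=
  bsum l (fun i => Y u (m + l - i%:Z) (Y v (n + i%:Z) w)).

Definition mode21 u v w l m n : V := (-1) ^ l *: mode12 v u w l n m.

Definition iter_mode u v w l m n : V :=
  bsum m (fun i => (-1) ^+ i *: Y (Y u (l + i%:Z) v) (m + n - i%:Z) w).

Lemma trunc_ev0 v w n : eventually0 (fun i => Y v (n + i%:Z) w).
Proof.
have [N hN] := state_field_trunc hY v w.
by exists `|N - n|%N => i iN; apply: hN; lia.
Qed.

Lemma mode12_ev0 u v w m n :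
  eventually0 (fun i => Y u (m - i%:Z) (Y v (n + i%:Z) w)).
Proof.
by have [N hN] := trunc_ev0 v w n; exists N => i /hN ->; rewrite mode0r.
Qed.

Lemma mode0_ev0 u v w l n :
  eventually0 (fun i => (-1) ^+ i *: Y (Y u (l + i%:Z) v) (n - i%:Z) w).
Proof.
by have [N hN] := trunc_ev0 u v l; exists N => i /hN ->; rewrite mode0l scaler0.
Qed.

Lemma mode12_rec u v w : rec3 (mode12 u v w).
Proof.
move=> l m n; rewrite {1}/mode12 bsum_pascal; last exact: mode12_ev0.
by congr (_ - _); apply: eq_bsum => i; congr (Y _ _ (Y _ _ _)); lia.
Qed.

Lemma mode21_rec u v w : rec3 (mode21 u v w).
Proof.
move=> l m n; rewrite /mode21 mode12_rec expfzDr ?oppr_eq0 ?oner_eq0//.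
by rewrite expr1z mulrN1 scaleNr -scalerN opprB scalerBr.
Qed.

(** Pascal's rule is applied to the exponent m: the two signs in [iter_mode] cancel, leaving the
    expansion of (x2 + x0)^m. *)
Lemma mode0_rec u v w : rec3 (iter_mode u v w).
Proof.
move=> l m n; rewrite {2}/iter_mode bsum_pascal; last exact: mode0_ev0.
rewrite addrAC (_ : bsum _ _ = iter_mode u v w l m (n + 1)); last first.
  by apply: eq_bsum => i; congr (_ *: Y _ _ _); lia.
rewrite subrr add0r -bsumN /iter_mode.
  by apply: eq_bsum => i; rewrite exprS mulN1r scaleNr opprK;
    congr (_ *: Y (Y _ _ _) _ _); lia.
have [N hN] := mode0_ev0 u v w l (m + 1 + n).
by exists N => i iN; apply: (hN i.+1); lia.
Qed.

Lemma mode12_0 u v w m n : mode12 u v w 0 m n = Y u m (Y v n w).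
Proof. by rewrite /mode12 bsum0; congr (Y _ _ (Y _ _ _)); lia. Qed.

Lemma mode21_0 u v w m n : mode21 u v w 0 m n = Y v n (Y u m w).
Proof. by rewrite /mode21 mode12_0 expr0z scale1r. Qed.

Lemma mode0_0 u v w l n : iter_mode u v w l 0 n = Y (Y u l v) n w.
Proof. by rewrite /iter_mode bsum0 scale1r; congr (Y (Y _ _ _) _ _); lia. Qed.

Lemma mode12_van u v w l m n N : (forall n, N <= n -> Y v n w = 0) ->
  N <= n -> mode12 u v w l m n = 0.
Proof.
by move=> vN Nn; apply: bsum_zero => i; rewrite vN ?mode0r//; lia.
Qed.

Lemma mode21_van u v w l m n M : (forall m, M <= m -> Y u m w = 0) ->
  M <= m -> mode21 u v w l m n = 0.
Proof. by move=> uM Mm; rewrite /mode21 (mode12_van _ _ _ uM)// scaler0. Qed.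

Lemma mode0_van u v w l m n L : (forall l, L <= l -> Y u l v = 0) ->
  L <= l -> iter_mode u v w l m n = 0.
Proof.
by move=> uL Ll; apply: bsum_zero => i; rewrite uL ?mode0l ?scaler0//; lia.
Qed.

Definition mode_commutator u v w (x : int * int) : V :=
  Y u x.1 (Y v x.2 w) - Y v x.2 (Y u x.1 w).

(** The exponent is uniform in [w], whereas that of [weak_assoc] may depend on [w]. *)
Definition locality k u v : Prop :=
  forall w, iter k (dop (-1) pshift1 pshift2) (mode_commutator u v w) = fun=> 0.

(* (x0 + x2)^k (Y(u, x0 + x2) Y(v, x2) w - Y(Y(u, x0) v, x2) w) = 0 *)
Definition weak_assoc k u v w : Prop :=
  iter k (dop 1 pshift1 pshift2)
    (fun x => mode12 u v w x.1 0 x.2 - Y (Y u x.1 v) x.2 w) = fun=> 0.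

Definition Borcherds u v : Prop := forall w l m n,
  mode12 u v w l m n - mode21 u v w l m n = iter_mode u v w l m n.

(** The difference of the two terms satisfies [rec3] and its slice l = 0 is the commutator, so its
    slice l = k is the commutator hit by the k-th power of the operator. *)
Lemma localityP k u v : locality k u v <->
  (forall w l m n, k%:Z <= l -> mode12 u v w l m n = mode21 u v w l m n).
Proof.
have rT w := rec3B (mode12_rec u v w) (mode21_rec u v w).
have T0E w : mode_commutator u v w =
  fun x => mode12 u v w 0 x.1 x.2 - mode21 u v w 0 x.1 x.2.
  by apply/funext => x; rewrite mode12_0 mode21_0.
split=> [uv w l m n kl|uv w].
  apply/eqP; rewrite -subr_eq0; apply/eqP.
  by apply: (rec3_iter_l_ge (rT w) _ _ _ kl); rewrite -T0E; exact: uv.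
by apply/funext => x; rewrite T0E -(rec3_iter_l (rT w)) uv// subrr.
Qed.

Lemma locality_sym k u v : locality k u v -> locality k v u.
Proof.
move=> /localityP uv; apply/localityP => w l m n kl.
rewrite /mode21 uv// /mode21 scalerA -expfzMl mulrNN mulr1 exp1rz scale1r//.
Qed.

Lemma locality_le k k' u v : (k <= k')%N -> locality k u v -> locality k' u v.
Proof. by move=> kk uv w; apply: iter_dop_eq0 (uv w). Qed.

(** For m >= k the term [mode21] vanishes. The exponent depends on [u] and [w] only, not on [v],
    which [weak_assoc_mode] exploits. *)
Lemma Borcherds_weak_assoc u v w k : Borcherds u v ->
  (forall m, k%:Z <= m -> Y u m w = 0) -> weak_assoc k u v w.
Proof.
move=> J uk.
have rT := rec3B (mode12_rec u v w) (mode0_rec u v w).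
rewrite /weak_assoc; apply/funext => x.
under eq_fun do rewrite -mode0_0.
rewrite -(rec3_iter_m rT) -J (mode21_van _ _ _ uk)// subr0 subrr//.
Qed.

(** The defect of the identity satisfies [rec3]. It vanishes for large l by locality and truncation
    of Y(u, x0)v, and for large m by weak associativity and truncation of Y(u, x1)w. *)
Lemma Borcherds_locality_weak_assoc k u v : locality k u v ->
  (forall w, exists k', weak_assoc k' u v w) -> Borcherds u v.
Proof.
move=> /localityP uv uvw w l m n; apply/eqP; rewrite -subr_eq0; apply/eqP;
  move: l m n.
have [k' kA] := uvw w.
have rT0 := rec3B (mode12_rec u v w) (mode0_rec u v w).
have rT := rec3B (rec3B (mode12_rec u v w) (mode21_rec u v w)) (mode0_rec u v w).
have [L hL] := state_field_trunc hY u v.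
have [M hM] := state_field_trunc hY u w.
apply: (rec3_eq0_lm rT (L := Num.max k%:Z L) (M := Num.max k'%:Z M)) => l m n.
  by rewrite ge_max => /andP[kl Ll]; rewrite uv// (mode0_van _ _ _ hL)// !subrr.
rewrite ge_max => /andP[km Mm]; rewrite (mode21_van _ _ _ hM)// subr0.
apply: (rec3_iter_m_ge rT0 _ _ _ km).
by under eq_fun do rewrite mode0_0.
Qed.

Lemma Borcherds_locality_iterate k u v : locality k u v ->
  (forall w l n, mode12 u v w l 0 n - mode21 u v w l 0 n = Y (Y u l v) n w) ->
    Borcherds u v.
Proof.
move=> /localityP uv uvw w l m n; apply/eqP; rewrite -subr_eq0; apply/eqP;
  move: l m n.
have rT := rec3B (rec3B (mode12_rec u v w) (mode21_rec u v w)) (mode0_rec u v w).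
have [L hL] := state_field_trunc hY u v.
apply: (rec3_eq0_l0 rT (L := Num.max k%:Z L)) => [l m n|l n].
  by rewrite ge_max => /andP[kl Ll]; rewrite uv// (mode0_van _ _ _ hL)// !subrr.
by rewrite uvw mode0_0 subrr.
Qed.

Lemma locality_linl c u u' v k : locality k u v -> locality k u' v ->
  locality k (c *: u + u') v.
Proof.
move=> uv uv' w.
have -> : mode_commutator (c *: u + u') v w =
  fun x => c *: mode_commutator u v w x + mode_commutator u' v w x.
  apply/funext => x; rewrite /mode_commutator !(state_field_linearl hY).
  by rewrite (state_field_linearr hY) opprD addrACA -scalerBr.
have cl : linear ( *:%R c : V -> V).
  by move=> a y z; rewrite scalerDr !scalerA mulrC.
rewrite iter_dopD (iter_dop_linear _ _ _ _ _ cl) uv uv'.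
by apply/funext => x; rewrite scaler0 addr0.
Qed.

Lemma mode12_linl c u u' v w l m n :
  mode12 (c *: u + u') v w l m n = c *: mode12 u v w l m n + mode12 u' v w l m n.
Proof.
rewrite /mode12 -bsum_lin; [|exact: mode12_ev0|exact: mode12_ev0].
by apply: eq_bsum => i; rewrite (state_field_linearl hY).
Qed.

Lemma mode12_linr c u v v' w l m n :
  mode12 u (c *: v + v') w l m n = c *: mode12 u v w l m n + mode12 u v' w l m n.
Proof.
rewrite /mode12 -bsum_lin; [|exact: mode12_ev0|exact: mode12_ev0].
by apply: eq_bsum => i; rewrite (state_field_linearl hY) (state_field_linearr hY).
Qed.

Lemma Borcherds_linl c u u' v : Borcherds u v -> Borcherds u' v ->
  Borcherds (c *: u + u') v.
Proof.
move=> uv uv' w l m n; rewrite /mode21 mode12_linr mode12_linl scalerDr opprD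
  addrACA.
rewrite -/(mode21 u' v w l m n) uv' scalerA [_ * c]mulrC -scalerA -scalerBr.
rewrite -/(mode21 u v w l m n) uv /iter_mode -bsum_lin;
  [|exact: mode0_ev0|exact: mode0_ev0].
apply: eq_bsum => i; rewrite !(state_field_linearl hY) scalerDr !scalerA.
by rewrite mulrC.
Qed.

End Borcherds.

(** * Dong's trick and locality *)

Notation triple := (int * int * int)%type.

Definition shift1 (x : triple) : triple := (x.1.1 + 1, x.1.2, x.2).
Definition shift2 (x : triple) : triple := (x.1.1, x.1.2 + 1, x.2).
Definition shift3 (x : triple) : triple := (x.1.1, x.1.2, x.2 + 1).
Definition swap12 (x : triple) : triple := (x.1.2, x.1.1, x.2).

Lemma swap12K : involutive swap12.
Proof. by move=> -[[]]. Qed.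

Section DongFamily.
Context {K : numFieldType} {V : lmodType K}.
Variable (s : K) (M : nat).

Definition dop_pow13 : (triple -> V) -> triple -> V := iter M (dop s shift1 shift3).
Definition dop_pow23 : (triple -> V) -> triple -> V := iter M (dop s shift2 shift3).

Lemma dop_powC f : dop_pow13 (dop_pow23 f) = dop_pow23 (dop_pow13 f).
Proof.
rewrite /dop_pow13; elim: {1 2}M => //= k ->.
by apply: iter_comm => g; apply: dop_pairC.
Qed.

Lemma dop_powD f g x : dop_pow13 (dop_pow23 (fun x => f x + g x)) x =
  dop_pow13 (dop_pow23 f) x + dop_pow13 (dop_pow23 g) x.
Proof. by rewrite /dop_pow13 /dop_pow23 !iter_dopD. Qed.

Lemma dop_powB f g x : dop_pow13 (dop_pow23 (fun x => f x - g x)) x =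
  dop_pow13 (dop_pow23 f) x - dop_pow13 (dop_pow23 g) x.
Proof. by rewrite /dop_pow13 /dop_pow23 !iter_dopB. Qed.

Lemma dop_powZ (c : K) f x : dop_pow13 (dop_pow23 (fun x => c *: f x)) x =
  c *: dop_pow13 (dop_pow23 f) x.
Proof.
have cl : linear ( *:%R c : V -> V).
  by move=> a u v; rewrite scalerDr !scalerA mulrC.
by rewrite /dop_pow13 /dop_pow23 !(iter_dop_linear _ _ _ _ _ cl).
Qed.

Lemma dop_pow_slice (phi : triple -> triple) f x :
  (forall x, phi (shift1 x) = shift1 (phi x)) ->
    (forall x, phi (shift2 x) = shift2 (phi x)) ->
  (forall x, phi (shift3 x) = shift3 (phi x)) ->
  dop_pow13 (dop_pow23 (fun x => f (phi x))) x = dop_pow13 (dop_pow23 f) (phi x).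
Proof.
move=> p1 p2 p3; rewrite /dop_pow13 /dop_pow23 (iter_dop_slice _ _ _ _ p1 p3).
congr (iter _ _ _ _); apply/funext => y.
by rewrite (iter_dop_slice _ _ _ _ p2 p3).
Qed.

(** The swap exchanges the two operators, and these commute. *)
Lemma dop_pow_swap12 f x : dop_pow13 (dop_pow23 (fun x => f (swap12 x))) x =
  dop_pow13 (dop_pow23 f) (swap12 x).
Proof.
rewrite dop_powC.
have p1 y : swap12 (shift1 y) = shift2 (swap12 y) by [].
have p2 y : swap12 (shift2 y) = shift1 (swap12 y) by [].
have p3 y : swap12 (shift3 y) = shift3 (swap12 y) by [].
have -> : dop_pow13 (dop_pow23 f) (swap12 x) =
  iter M (dop s shift2 shift3) (fun y => dop_pow23 f (swap12 y)) x.
  by rewrite /dop_pow13 (iter_dop_slice _ _ _ _ p2 p3).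
congr (iter _ _ _ _); apply/funext => y.
by rewrite /dop_pow23 (iter_dop_slice _ _ _ _ p1 p3).
Qed.

(** The bound depends on p3 alone: [rec3_eq0_n], applied with p3 frozen, needs one bound for all q
    and p1. *)
Definition vanish2 (X : int -> triple -> V) : Prop := forall p3, exists N : int,
  forall q p1 p2, N <= p2 -> X q (p1, p2, p3) = 0.

Lemma vanish2_iter k (X : int -> triple -> V) (si : triple -> triple) :
  (forall x, (si x).2 = x.2) -> (forall x, x.1.2 <= (si x).1.2) ->
  vanish2 X -> vanish2 (fun q => iter k (dop s si shift3) (X q)).
Proof.
move=> si3 si2 vX; elim: k => [|k IH] p3 //=.
have [N hN] := IH p3; have [N' hN'] := IH (p3 + 1).
exists (Num.max N N') => q p1 p2; rewrite ge_max => /andP[Np N'p].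
rewrite {1}/dop hN' // scaler0 addr0.
have := si3 (p1, p2, p3); have := si2 (p1, p2, p3).
case: (si _) => -[y1 y2] y3 /= py ->; apply: hN; exact: le_trans Np py.
Qed.

(** The operators commute with the shifts, so for fixed p3 the transformed family solves [rec3] in
    (q, p1, p2), and its slice q = 0 determines it. *)
Lemma dop_pow_family_eq0 (X : int -> triple -> V) :
  (forall q x, X (q + 1) x = X q (shift1 x) - X q (shift2 x)) ->
  vanish2 X -> (forall x, dop_pow13 (dop_pow23 (X 0)) x = 0) ->
  forall q x, dop_pow13 (dop_pow23 (X q)) x = 0.
Proof.
move=> rX vX X0 q [[p1 p2] p3].
have vX' : vanish2 (fun q => dop_pow13 (dop_pow23 (X q))).
  apply: vanish2_iter => [//|x //|]; apply: vanish2_iter => [//|x|//].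
  by rewrite /shift2 /=; lia.
have [N hN] := vX' p3.
apply: (@rec3_eq0_n _ (fun q p1 p2 => dop_pow13 (dop_pow23 (X q)) (p1, p2,
  p3)) N) => //.
move=> l m n.
have -> : X (l + 1) = fun x => X l (shift1 x) - X l (shift2 x) by apply/funext => x.
rewrite (dop_powB (fun x => X l (shift1 x)) (fun x => X l (shift2 x))).
by rewrite (@dop_pow_slice shift1 (X l))// (@dop_pow_slice shift2 (X l)).
Qed.

(* X and X' play the roles of a(x1) b(x2) and b(x2) a(x1): each is determined by
   its slice q = 0 but in opposite expansion regions, so A^M B^M kills all slices
   as soon as it kills both slices at 0, while only the difference vanishes for
   large q. *)
Lemma Dong_family (X X' : int -> triple -> V) (N : int) :
  (forall q x, X (q + 1) x = X q (shift1 x) - X q (shift2 x)) ->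
  (forall q x, X' (q + 1) x = X' q (shift1 x) - X' q (shift2 x)) ->
  vanish2 X -> vanish2 X' ->
  (forall x, dop_pow13 (dop_pow23 (X 0)) x = 0) ->
    (forall x, dop_pow13 (dop_pow23 (X' 0)) x = 0) ->
  (forall q x, N <= q -> X q x - (-1) ^ q *: X' q (swap12 x) = 0) ->
  forall d q, N <= q + d%:Z ->
    iter (M + M * d) (dop s shift2 shift3) (fun x => X q x - (-1) ^ q *: X' q
      (swap12 x))
    = fun=> 0.
Proof.
move=> rX rX' vX vX' X0 X'0 XN.
apply: (@Dong_kill _ _ _ s shift1 shift2 shift3 _ _ _
  (fun q x => X q x - (-1) ^ q *: X' q (swap12 x))) => // [q x|q].
  (* The sign (-1)^q compensates the exchange of [shift1] and [shift2] by the swap. *)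
  rewrite rX rX' expfzDr ?oppr_eq0 ?oner_eq0// expr1z mulrN1 scaleNr opprK.
  by rewrite scalerBr opprB addrACA [RHS]addrACA; congr (_ + _); exact: addrC.
rewrite -/(dop_pow13 _) -/(dop_pow23 _); apply/funext => x.
rewrite (dop_powB (X q) (fun x => (-1) ^ q *: X' q (swap12 x))).
rewrite (dop_powZ _ (fun x => X' q (swap12 x))) dop_pow_swap12.
by rewrite !dop_pow_family_eq0// scaler0 subrr.
Qed.

End DongFamily.

Section DongLocality.
Context {K : numFieldType} {V : lmodType K}.
Variables (Y : V -> int -> V -> V) (hY : state_field Y).
Implicit Types (a b u v w z : V).

Notation mode12 := (mode12 Y).
Notation mode21 := (mode21 Y).
Notation iter_mode := (iter_mode Y).
Notation mode_commutator := (mode_commutator Y).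
Notation locality := (locality Y).
Notation Borcherds := (Borcherds Y).

(** The commutator of (x1 - x2)^q Y(a, x1) Y(b, x2) with Y(v, x3), applied to [w]. *)
Let X a b v w (q : int) (x : triple) : V :=
  mode12 a b (Y v x.2 w) q x.1.1 x.1.2 - Y v x.2 (mode12 a b w q x.1.1 x.1.2).

Lemma Dong_X_rec a b v w q x :
  X a b v w (q + 1) x = X a b v w q (shift1 x) - X a b v w q (shift2 x).
Proof. by rewrite /X !(mode12_rec hY) (modeBr hY) opprD addrACA -opprD. Qed.

Lemma Dong_X_van a b v w : vanish2 (X a b v w).
Proof.
move=> p3; have [N hN] := state_field_trunc hY b (Y v p3 w).
have [N' hN'] := state_field_trunc hY b w.
exists (Num.max N N') => q p1 p2; rewrite ge_max => /andP[Np N'p].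
by rewrite /X !(mode12_van hY _ _ _ hN,
  mode12_van hY _ _ _ hN')//= (mode0r hY) subrr.
Qed.

(** By [ab, v] = a [b, v] + [a, v] b: the power in modes 2 and 3 kills the first summand, the power
    in modes 1 and 3 the second. *)
Lemma Dong_X_0 a b v w M x : locality M a v -> locality M b v ->
  dop_pow13 (-1) M (dop_pow23 (-1) M (X a b v w 0)) x = 0.
Proof.
move=> av bv.
pose f1 (x : triple) := Y a x.1.1 (mode_commutator b v w (x.1.2, x.2)).
pose f2 (x : triple) := mode_commutator a v (Y b x.1.2 w) (x.1.1, x.2).
have -> : X a b v w 0 = fun x => f1 x + f2 x.
  apply/funext => y; rewrite /X /f1 /f2 !mode12_0 /mode_commutator (modeBr hY) /=.
  by rewrite addrA subrK.
rewrite dop_powD.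
have -> : dop_pow23 (-1) M f1 = fun=> 0.
  apply/funext => -[[y1 y2] y3]; rewrite /dop_pow23.
  rewrite (@iter_dop_slice _ _ _ _ (fun y => (y1, y.1,
    y.2)) _ _ pshift1 pshift2 _ _ _ (y2, y3))//.
  rewrite (@iter_dop_linear _ _ _ _ _ _ _ (Y a y1) (fun y => mode_commutator b v
    w (y.1, y.2))).
    by rewrite [X in iter _ _ X](_ : _ =
      mode_commutator b v w) ?bv ?(mode0r hY)//; apply/funext => -[].
  exact: state_field_linearr hY _ _.
have -> : dop_pow13 (-1) M (dop_pow23 (-1) M f2) = fun=> 0.
  rewrite dop_powC; have -> : dop_pow13 (-1) M f2 = fun=> 0.
    apply/funext => -[[y1 y2] y3]; rewrite /dop_pow13.
    rewrite (@iter_dop_slice _ _ _ _ (fun y => (y.1, y2,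
      y.2)) _ _ pshift1 pshift2 _ _ _ (y1, y3))//.
    by rewrite [X in iter _ _ X](_ : _ = mode_commutator a v (Y b y2 w)) ?av.
  by rewrite /dop_pow23 iter_dop0.
by rewrite /dop_pow13 iter_dop0 addr0.
Qed.

Lemma locality_mode a b v r :
  Borcherds a b -> (exists k, locality k a b) -> (exists k, locality k a v) ->
  (exists k, locality k b v) -> exists k, locality k (Y a r b) v.
Proof.
move=> Jab [k /(localityP hY) ab] [k1 av] [k2 bv].
pose M := maxn k1 k2.
have {}av : locality M a v by apply: locality_le av; exact: leq_maxl.
have {}bv : locality M b v by apply: locality_le bv; exact: leq_maxr.
(* The family vanishes from q = k on, by locality of [a] and [b]; [d] is enough steps to descend
   from there to r. *)
pose d := `|k%:Z - r|%N.
exists (M + M * d)%N => w.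
have := @Dong_family _ _ (-1) M (X a b v w) (X b a v w) k
  (Dong_X_rec a b v w) (Dong_X_rec b a v w) (@Dong_X_van _ _ _ _) (@Dong_X_van _
    _ _ _)
  (fun x => Dong_X_0 w x av bv) (fun x => Dong_X_0 w x bv av).
have XE q x : X a b v w q x - (-1) ^ q *: X b a v w q (swap12 x) =
    (mode12 a b (Y v x.2 w) q x.1.1 x.1.2 - mode21 a b (Y v x.2 w) q x.1.1 x.1.2)
    - Y v x.2 (mode12 a b w q x.1.1 x.1.2 - mode21 a b w q x.1.1 x.1.2).
  by rewrite /X (modeBr hY) /mode21 (modeZr hY) scalerBr opprD addrACA -opprD.
have XN q x : k%:Z <= q -> X a b v w q x - (-1) ^ q *: X b a v w q (swap12 x) = 0.
  by move=> kq; rewrite XE !(ab _ _ _ _ kq) !subrr (mode0r hY) subrr.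
have dr : k%:Z <= r + d%:Z by rewrite /d; lia.
move=> /(_ XN d r dr) H; apply/funext => y.
(* On the slice p1 = 0, the Jacobi identity for (a, b) turns the family at q = r into the commutator
   of a_r b with v. *)
have {H} := congr1 (@^~ (0, y.1, y.2)) H; rewrite /=.
rewrite (@iter_dop_slice _ _ _ _ (fun y => (0, y.1,
  y.2)) _ _ pshift1 pshift2 _ _ _ y)// => <-.
congr (iter _ _ _ _); apply/funext => z.
by rewrite XE /= !Jab !mode0_0.
Qed.

End DongLocality.

(** * Weak associativity *)

Section Translation.
Context {K : numFieldType} {V : lmodType K}.
Implicit Types (f g : triple -> V) (X : int -> triple -> V).

(* [translate1] (resp. [translate2]) re-expands a series in x1 = x13 + x3 (resp.
   x2 = x23 + x3) in nonnegative powers of x3,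
     so it intertwines S1 with S13 + S3. *)
Definition translate1 f (x : triple) : V :=
  bsum x.1.1 (fun i => f (x.1.1 - i%:Z, x.1.2, x.2 + i%:Z)).

Definition translate2 f (x : triple) : V :=
  bsum x.1.2 (fun i => f (x.1.1, x.1.2 - i%:Z, x.2 + i%:Z)).

Lemma translate2_swap12 f x : translate2 f x =
  translate1 (fun y => f (swap12 y)) (swap12 x).
Proof. by []. Qed.

(** The bound may depend on p2, as it does for Y(Y(b, x2)v, x3)w; [translate1] leaves p2 fixed, so
    its sums are still finite. Exchanging both translations uses the uniform [utrunc3]. *)
Definition trunc3 f : Prop := forall p2, exists N : int,
  forall p1 p3, N <= p3 -> f (p1, p2, p3) = 0.

Definition utrunc3 X : Prop := exists N : int,
  forall (q : int) (x : triple), N <= x.2 -> X q x = 0.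

Lemma translate1_ev0 f (p1 p2 p3 : int) : trunc3 f ->
  eventually0 (fun i => f (p1 - i%:Z, p2, p3 + i%:Z)).
Proof.
move=> /(_ p2)[N hN]; exists `|N - p3|%N => i iN; apply: hN; lia.
Qed.

Lemma translate1_lin c f g x : trunc3 f -> trunc3 g ->
  translate1 (fun y => c *: f y + g y) x = c *: translate1 f x + translate1 g x.
Proof. by move=> tf tg; rewrite /translate1 -bsum_lin//; exact: translate1_ev0. Qed.

Lemma translate1D f g x : trunc3 f -> trunc3 g ->
  translate1 (fun y => f y + g y) x = translate1 f x + translate1 g x.
Proof. by move=> tf tg; rewrite /translate1 -bsumD//; exact: translate1_ev0. Qed.

Lemma translate1B f g x : trunc3 f -> trunc3 g ->
  translate1 (fun y => f y - g y) x = translate1 f x - translate1 g x.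
Proof. by move=> tf tg; rewrite /translate1 -bsumB//; exact: translate1_ev0. Qed.

(** Pascal's rule for the binomials with upper index p1 + 1. *)
Lemma translate1_shift1 f x : trunc3 f ->
  translate1 (fun y => f (shift1 y)) x =
    translate1 f (shift1 x) + translate1 f (shift3 x).
Proof.
move=> tf; rewrite /translate1 /= bsum_pascal; last exact: translate1_ev0.
rewrite -[RHS]addrA [X in _ + X](_ : _ = 0) ?addr0.
  by apply: eq_bsum => i; rewrite /shift1 /=; congr (f (_, _, _)); lia.
apply/eqP; rewrite addrC subr_eq0; apply/eqP/eq_bsum => i.
by congr (f (_, _, _)); lia.
Qed.

Lemma translate1_shift2 f x : translate1 (fun y => f (shift2 y)) x =
  translate1 f (shift2 x).
Proof. by []. Qed.

Lemma translate1_shift3 f x : translate1 (fun y => f (shift3 y)) x =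
  translate1 f (shift3 x).
Proof.
by apply: eq_bsum => i; rewrite /shift3 /=; congr (f (_, _, _)); lia.
Qed.

Lemma trunc3_shift1 f : trunc3 f -> trunc3 (fun y => f (shift1 y)).
Proof. by move=> tf p2; have [N hN] := tf p2; exists N => p1 p3 Np; exact: hN. Qed.

Lemma trunc3_shift2 f : trunc3 f -> trunc3 (fun y => f (shift2 y)).
Proof. by move=> tf p2; have [N hN] := tf (p2 + 1); exists N => p1 p3 Np;
  exact: hN. Qed.

Lemma trunc3_shift3 f : trunc3 f -> trunc3 (fun y => f (shift3 y)).
Proof.
move=> tf p2; have [N hN] := tf p2; exists N => p1 p3 Np; apply: hN => /=; lia.
Qed.

Lemma trunc3D f g : trunc3 f -> trunc3 g -> trunc3 (fun y => f y + g y).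
Proof.
move=> tf tg p2; have [N hN] := tf p2; have [N' hN'] := tg p2.
exists (Num.max N N') => p1 p3; rewrite ge_max => /andP[Np N'p].
by rewrite hN// hN'// addr0.
Qed.

Lemma trunc3Z c f : trunc3 f -> trunc3 (fun y => c *: f y).
Proof.
move=> tf p2; have [N hN] := tf p2; exists N => p1 p3 /hN ->.
by rewrite scaler0.
Qed.

Lemma dop_pow23_translate1 k f : trunc3 f ->
  dop_pow23 1 k (translate1 f) = translate1 (dop_pow23 1 k f).
Proof.
move=> tf.
have th j : trunc3 (dop_pow23 1 j f).
  elim: j => //= j IH; apply: trunc3D; first exact: trunc3_shift2.
  by apply: trunc3Z; exact: trunc3_shift3.
elim: k => //= k IH; rewrite {1}/dop_pow23 /= -/(dop_pow23 1 k (translate1 f)) IH.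
apply/funext => x; rewrite {2}/dop_pow23 /= -/(dop_pow23 1 k f) /dop translate1D.
- by rewrite translate1_shift2 !scale1r; congr (_ + _);
  under eq_fun do rewrite scale1r; rewrite translate1_shift3.
- exact: trunc3_shift2.
- by apply: trunc3Z; exact: trunc3_shift3.
Qed.

Lemma utrunc3_trunc3 X q : utrunc3 X -> trunc3 (X q).
Proof. by move=> [N hN] p2; exists N => p1 p3 Np; apply: hN. Qed.

Lemma utrunc3_translate1 X : utrunc3 X -> utrunc3 (fun q => translate1 (X q)).
Proof.
move=> [N hN]; exists N => q x Nx; apply: bsum_zero => i; apply: hN => /=; lia.
Qed.

Lemma utrunc3_translate2 X : utrunc3 X -> utrunc3 (fun q => translate2 (X q)).
Proof.
move=> [N hN]; exists N => q x Nx; apply: bsum_zero => i; apply: hN => /=; lia.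
Qed.

Lemma translate12C X q x : utrunc3 X ->
  translate1 (translate2 (X q)) x = translate2 (translate1 (X q)) x.
Proof.
move=> uX; have [N hN] := uX; have [N1 hN1] := utrunc3_translate1 uX.
have [N2 hN2] := utrunc3_translate2 uX.
(* Beyond [n] the inner and outer sums of both sides vanish, so all become sums over the same finite
   range. *)
pose n := (`|N - x.2| + `|N1 - x.2| + `|N2 - x.2|)%N.
have nE i : (n <= i)%N ->
    [/\ N <= x.2 + i%:Z, N1 <= x.2 + i%:Z & N2 <= x.2 + i%:Z].
  by rewrite /n => ni; split; lia.
rewrite [LHS](@bsumE _ _ n) => [|i /nE[_ _ N2i]]; last exact: hN2.
rewrite [RHS](@bsumE _ _ n) => [|i /nE[_ N1i _]]; last exact: hN1.
under eq_bigr => i _.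
  rewrite /translate2 (@bsumE _ _ n) => [|j /nE[nj _ _]];
    last by apply: hN => /=; lia.
  rewrite scaler_sumr; over.
under [RHS]eq_bigr => i _.
  rewrite /translate1 (@bsumE _ _ n) => [|j /nE[nj _ _]];
    last by apply: hN => /=; lia.
  rewrite scaler_sumr; over.
rewrite exchange_big; apply: eq_bigr => i _; apply: eq_bigr => j _ /=.
rewrite !scalerA mulrC; congr (_ *: X q (_, _, _)); lia.
Qed.

(** Translation preserves the difference: x1 - x2 = (x13 + x3) - (x23 + x3) = x13 - x23. *)
Lemma utrunc3B_rec X : utrunc3 X ->
  (forall q x, X (q + 1) x = X q (shift1 x) - X q (shift2 x)) ->
  forall q x, translate1 (translate2 (X (q + 1))) x =
    translate1 (translate2 (X q)) (shift1 x) - translate1 (translate2 (X q))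
      (shift2 x).
Proof.
move=> uX rX q x.
have tX : trunc3 (fun y => X q (swap12 y)).
  by have [N hN] := uX => p2; exists N => p1 p3 Np; apply: hN.
have tC : trunc3 (translate2 (X q)) := utrunc3_trunc3 q (utrunc3_translate2 uX).
have -> : translate2 (X (q + 1)) =
  fun y => translate2 (X q) (shift1 y) - (translate2 (X q) (shift2 y) +
    translate2 (X q) (shift3 y)).
  apply/funext => y; rewrite !translate2_swap12.
  rewrite -(translate1_shift1 (swap12 y) tX) -(translate1_shift2 (fun y => X q
    (swap12 y)) (swap12 y)).
  rewrite -translate1B; [|exact: (trunc3_shift2 tX)|exact: (trunc3_shift1 tX)].
  by congr (translate1 _ _); apply/funext => z; rewrite rX.
rewrite translate1B ?translate1D ?translate1_shift1 ?translate1_shift2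
  ?translate1_shift3//.
- by rewrite opprD addrACA subrr addr0.
- exact: trunc3_shift2.
- exact: trunc3_shift3.
- exact: trunc3_shift1.
- by apply: trunc3D; [exact: trunc3_shift2|exact: trunc3_shift3].
Qed.

Lemma vanish2_bound X (p3 : int) n : vanish2 X -> exists N : int,
  forall i q p1 p2, (i < n)%N -> N <= p2 -> X q (p1, p2, p3 + i%:Z) = 0.
Proof.
move=> vX; elim: n => [|n [N hN]]; first by exists 0.
have [N' hN'] := vX (p3 + n%:Z); exists (Num.max N N') => i q p1 p2.
rewrite ltnS leq_eqVlt ge_max => /predU1P[->|ni] /andP[Np N'p];
  [exact: hN'|exact: hN].
Qed.

Lemma vanish2_translate1 X : utrunc3 X -> vanish2 X ->
  vanish2 (fun q => translate1 (X q)).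
Proof.
move=> [N3 h3] vX p3; have [N hN] := vanish2_bound p3 `|N3 - p3|%N vX.
exists N => q p1 p2 Np; apply: bsum_zero => i /=.
have [iN|iN] := ltnP i `|N3 - p3|%N; first exact: hN.
by apply: h3 => /=; lia.
Qed.

Lemma vanish2_translate2 X : utrunc3 X -> vanish2 X ->
  vanish2 (fun q => translate2 (X q)).
Proof.
move=> [N3 h3] vX p3; have [N hN] := vanish2_bound p3 `|N3 - p3|%N vX.
(* Here the second exponent is itself lowered by i, and only i below this distance contribute. *)
exists (N + `|N3 - p3|%N) => q p1 p2 Np; apply: bsum_zero => i /=.
have [iN|iN] := ltnP i `|N3 - p3|%N; first by apply: hN => //; lia.
by apply: h3 => /=; lia.
Qed.

End Translation.

Section WeakAssociativity.
Context {K : numFieldType} {V : lmodType K}.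
Variables (Y : V -> int -> V -> V) (hY : state_field Y).
Implicit Types (a b u v w z : V).

Notation mode12 := (mode12 Y).
Notation mode21 := (mode21 Y).
Notation iter_mode := (iter_mode Y).
Notation locality := (locality Y).
Notation Borcherds := (Borcherds Y).
Notation weak_assoc := (weak_assoc Y).

Let G a b v w (q : int) (y : triple) : V := mode12 a b (Y v y.2 w) q y.1.1 y.1.2.

(** The associativity defect of a product: (x13 - x23)^q times Y(a, x13 + x3) Y(b, x23 + x3) Y(v,
    x3) w - Y(Y(a, x13) Y(b, x23) v, x3) w. *)
Let X a b v w (q : int) (x : triple) : V :=
  translate1 (translate2 (G a b v w q)) x - Y (mode12 a b v q x.1.1 x.1.2) x.2 w.

Lemma mode12_0r a b q m n : mode12 a b 0 q m n = 0.
Proof. by apply: bsum_zero => i; rewrite !(mode0r hY). Qed.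

Lemma assoc_G_utrunc a b v w : utrunc3 (G a b v w).
Proof.
have [N hN] := state_field_trunc hY v w.
by exists N => q x Nx; rewrite /G hN// mode12_0r.
Qed.

Lemma assoc_G_rec a b v w q x :
  G a b v w (q + 1) x = G a b v w q (shift1 x) - G a b v w q (shift2 x).
Proof. by rewrite /G (mode12_rec hY). Qed.

Lemma assoc_X_rec a b v w q x :
  X a b v w (q + 1) x = X a b v w q (shift1 x) - X a b v w q (shift2 x).
Proof.
rewrite /X (utrunc3B_rec (assoc_G_utrunc a b v w) (@assoc_G_rec a b v w)).
by rewrite (mode12_rec hY) (modeBl hY) opprD addrACA -opprD.
Qed.

Lemma assoc_X_van a b v w : vanish2 (X a b v w).
Proof.
have uG := assoc_G_utrunc a b v w.
have vG : vanish2 (G a b v w).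
  move=> p3; have [N hN] := state_field_trunc hY b (Y v p3 w).
  by exists N => q p1 p2 Np; apply: (mode12_van hY _ _ _ hN).
move=> p3; have [N hN] :=
  vanish2_translate1 (utrunc3_translate2 uG) (vanish2_translate2 uG vG) p3.
have [N' hN'] := state_field_trunc hY b v.
exists (Num.max N N') => q p1 p2; rewrite ge_max => /andP[Np N'p].
by rewrite /X hN// (mode12_van hY _ _ _ hN')//= (mode0l hY) subrr.
Qed.

(** Insert Y(a, x13 + x3) Y(Y(b, x23)v, x3) w. One difference is Y(a, x13 + x3) applied to the
    defect of (b, v); the other is the defect of [a] with the modes b_(p2) v, hence the hypothesis
    for all [y]. *)
Lemma assoc_X_0 a b v w M x :
  (forall y, weak_assoc M a y w) -> weak_assoc M b v w ->
  dop_pow13 1 M (dop_pow23 1 M (X a b v w 0)) x = 0.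
Proof.
move=> wa wb.
pose psi (y : int * int) := mode12 b v w y.1 0 y.2 - Y (Y b y.1 v) y.2 w.
pose k (x : triple) := Y a x.1.1 (psi (x.1.2, x.2)).
pose f2 (x : triple) := mode12 a (Y b x.1.2 v) w x.1.1 0 x.2
                    - Y (Y a x.1.1 (Y b x.1.2 v)) x.2 w.
pose g (x : triple) := Y a x.1.1 (Y (Y b x.1.2 v) x.2 w).
have translate2G : translate2 (G a b v w 0) =
  fun x => Y a x.1.1 (mode12 b v w x.1.2 0 x.2).
  apply/funext => y; rewrite /mode12 (linear_bsum _ (state_field_linearr hY _ _)).
    by apply: eq_bsum => i; rewrite /G mode12_0 add0r.
  exact: mode12_ev0.
have tC : trunc3 (translate2 (G a b v w 0)) :=
  utrunc3_trunc3 0 (utrunc3_translate2 (assoc_G_utrunc a b v w)).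
have tg : trunc3 g.
  move=> p2; have [N hN] := state_field_trunc hY (Y b p2 v) w.
  by exists N => p1 p3 Np; rewrite /g /= hN// (mode0r hY).
have kE : k = fun x => translate2 (G a b v w 0) x - g x.
  by apply/funext => y; rewrite translate2G /k /psi (modeBr hY).
have tk : trunc3 k.
  move=> p2; have [N hN] := tC p2; have [N' hN'] := tg p2.
  exists (Num.max N N') => p1 p3; rewrite ge_max => /andP[Np N'p].
  by rewrite kE hN// hN'// subrr.
have -> : X a b v w 0 = fun x => translate1 k x + f2 x.
  apply/funext => y; rewrite /X kE translate1B// /f2 mode12_0 addrA; congr (_ - _).
  rewrite -[LHS]addr0 -addrA; congr (_ + _); rewrite addrC; apply/esym/eqP.
  rewrite subr_eq0; apply/eqP.
  by apply: eq_bsum => i; rewrite /g /= add0r.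
rewrite dop_powD dop_pow23_translate1//.
have -> : dop_pow23 1 M k = fun=> 0.
  apply/funext => -[[y1 y2] y3]; rewrite /dop_pow23.
  rewrite (@iter_dop_slice _ _ _ _ (fun y => (y1, y.1,
    y.2)) _ _ pshift1 pshift2 _ _ _ (y2, y3))//.
  rewrite (@iter_dop_linear _ _ _ _ _ _ _ (Y a y1) (fun y => psi (y.1, y.2))).
    by rewrite [X in iter _ _ X](_ : _ = psi) ?wb ?(mode0r hY)//;
      apply/funext => -[].
  exact: state_field_linearr hY _ _.
have -> : translate1 (fun=> 0 : V) = fun=> 0 by apply/funext => y; apply: bsum_zero.
have -> : dop_pow13 1 M (dop_pow23 1 M f2) = fun=> 0.
  rewrite dop_powC; have -> : dop_pow13 1 M f2 = fun=> 0.
    apply/funext => -[[y1 y2] y3]; rewrite /dop_pow13.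
    rewrite (@iter_dop_slice _ _ _ _ (fun y => (y.1, y2,
      y.2)) _ _ pshift1 pshift2 _ _ _ (y1, y3))//.
    by have := wa (Y b y2 v); rewrite /weak_assoc => ->.
  by rewrite /dop_pow23 iter_dop0.
by rewrite /dop_pow13 iter_dop0 addr0.
Qed.

Lemma weak_assoc_mode a b v w r :
  (forall v, Borcherds a v) -> (forall v, Borcherds b v) ->
    exists k, weak_assoc k (Y a r b) v w.
Proof.
move=> Ja Jb.
have [N1 hN1] := state_field_trunc hY a w.
have [N2 hN2] := state_field_trunc hY b w.
pose M := (`|N1| + `|N2|)%N.
have wa y : weak_assoc M a y w.
  by apply: Borcherds_weak_assoc => // m Mm; apply: hN1; rewrite /M in Mm; lia.
have wb y : weak_assoc M b y w.
  by apply: Borcherds_weak_assoc => // m Mm; apply: hN2; rewrite /M in Mm; lia.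
have [L hL] := state_field_trunc hY a b.
pose d := `|L - r|%N.
exists (M + M * d)%N.
have := @Dong_family _ _ 1 M (X a b v w) (X b a v w) L
  (@assoc_X_rec a b v w) (@assoc_X_rec b a v w) (@assoc_X_van _ _ _ _)
    (@assoc_X_van _ _ _ _)
  (fun x => assoc_X_0 x wa (wb v)) (fun x => assoc_X_0 x wb (wa v)).
have XE q x : X a b v w q x - (-1) ^ q *: X b a v w q (swap12 x) =
    translate1 (translate2 (fun y => iter_mode a b (Y v y.2 w) q y.1.1 y.1.2)) x
    - Y (iter_mode a b v q x.1.1 x.1.2) x.2 w.
  rewrite /X scalerBr opprD addrACA -opprD -(modeZl hY) -(modeBl hY) -/(mode21 _
    _ _ _ _ _).
  rewrite Ja; congr (_ - _).
  (* Swapping the modes also exchanges the two translations; commuting them aligns both products so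
     that the Jacobi identity for (a, b) applies under the translations. *)
  rewrite [translate1 (translate2 (G b a v w q)) _]translate12C;
    last exact: assoc_G_utrunc.
  have uG := assoc_G_utrunc a b v w; have uG' := assoc_G_utrunc b a v w.
  have tG' : trunc3 (fun y => G b a v w q (swap12 y)).
    by have [N hN] := uG' => p2; exists N => p1 p3 Np; apply: hN.
  rewrite [translate2 (translate1 _) _]translate2_swap12 -scaleNr addrC
    -translate1_lin.
  - rewrite swap12K; congr (translate1 _ _); apply/funext => y;
    rewrite !translate2_swap12 -translate1_lin.
    + congr (translate1 _ _); apply/funext => z.
      by rewrite addrC scaleNr /= -Ja.
    + by have [N hN] := uG' => p2; exists N => p1 p3 Np; apply: hN.
    + by have [N hN] := uG => p2; exists N => p1 p3 Np; apply: hN.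
  - by have [N hN] := utrunc3_translate1 uG' => p2; exists N => p1 p3 Np; apply: hN.
  - exact: utrunc3_trunc3 q (utrunc3_translate2 uG).
have XN q x : L <= q -> X a b v w q x - (-1) ^ q *: X b a v w q (swap12 x) = 0.
  move=> Lq; rewrite XE (mode0_van hY _ _ _ hL)// (mode0l hY) subr0.
  by apply: bsum_zero => i; apply: bsum_zero => j; rewrite (mode0_van hY _ _ _ hL).
have dr : L <= r + d%:Z by rewrite /d; lia.
move=> /(_ XN d r dr) H; apply/funext => y.
have {H} := congr1 (@^~ (0, y.1, y.2)) H; rewrite /=.
rewrite (@iter_dop_slice _ _ _ _ (fun y => (0, y.1,
  y.2)) _ _ pshift1 pshift2 _ _ _ y)// => <-.
congr (iter _ _ _ _); apply/funext => z.
rewrite XE /= mode0_0; congr (_ - _).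
(* At p1 = 0 the outer translation is the identity, and the inner one is the expansion in [mode12]
   at m = 0. *)
rewrite {1}/translate1 bsum0; apply: eq_bsum => i /=.
rewrite subr0 mode0_0; congr (Y _ _ (Y _ _ _)); lia.
Qed.

Lemma Borcherds_mode a b v r k :
  (forall v, Borcherds a v) -> (forall v, Borcherds b v) ->
    locality k (Y a r b) v ->
  Borcherds (Y a r b) v.
Proof.
move=> Ja Jb lab; apply: (Borcherds_locality_weak_assoc hY lab) => w;
  exact: weak_assoc_mode.
Qed.

End WeakAssociativity.

(** * Reindexing of sums and multiples of exponent vectors *)

Lemma fsbig_inj (W : nmodType) (T : choiceType) (h : nat -> T) (F : T -> W) :
  injective h -> (forall q, (forall j, q <> h j) -> F q = 0) ->
  \sum_(q \in [set: T]) F q = \sum_(j \in [set: nat]) F (h j).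
Proof.
move=> hI F0; rewrite -(fsbig_image [set: nat] h F); last by move=> i j _ _;
  exact: hI.
apply/esym/fsbig_widen => // q [_ /= qh]; apply: F0 => j qj.
by apply: qh; exists j.
Qed.

Lemma mulrz_triple (a b c k : int) :
  ((a, b, c) : monom) *~ k = (a * k, b * k, c * k) :> monom.
Proof.
have N (n : nat) : ((a, b, c) : monom) *+ n =
  (a * n%:Z, b * n%:Z, c * n%:Z) :> monom.
  elim: n => [|n IH]; first by rewrite mulr0n !mulr0.
  by rewrite mulrSr IH; congr (_, _, _); rewrite /= intS; ring.
case: k => n; first exact: N.
rewrite NegzE mulrNz -pmulrn N; congr (_, _, _); by rewrite /= mulrN.
Qed.

(** * Coefficients of the formal series *)

Section PowB.
Context {K : numFieldType}.
Implicit Types (x y z p : monom) (n : int).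

Lemma powB_at x y n (j : nat) :
  injective (fun i : nat => x *~ (n - i%:Z) + y *~ i%:Z) ->
  powB K x y n (x *~ (n - j%:Z) + y *~ j%:Z) = (-1) ^+ j * gbinom K n j.
Proof.
move=> xyI; rewrite /powB (@fsbig_single _ _ _ j) ?eqxx// => i ij.
by case: eqP => // /xyI ji; rewrite ji eqxx in ij.
Qed.

Lemma powB_off x y n p : (forall j : nat, p <> x *~ (n - j%:Z) + y *~ j%:Z) ->
  powB K x y n p = 0.
Proof. by move=> pxy; apply: fsbig_zero => i; case: eqP => // /pxy. Qed.

Lemma deltaB_single (s : K) z x y n p :
  (forall m, m <> n -> powB K x y m (p + z *~ (m + 1)) = 0) ->
  deltaB s z x y p = s ^ (- n) * powB K x y n (p + z *~ (n + 1)).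
Proof.
move=> h; rewrite /deltaB (@fsbig_single _ _ _ n)// => m /eqP mn.
by rewrite h// mulr0.
Qed.

End PowB.


Section PowBCoefficients.
Context {K : numFieldType}.
Implicit Types (a b c n : int) (j : nat).

Lemma mulrz_x1x2 a b : x1 *~ a + x2 *~ b = (0, a, b).
Proof. by rewrite /x1 /x2 !mulrz_triple; congr (_, _, _) => /=; lia. Qed.

Lemma mulrz_x2x1 a b : x2 *~ a + x1 *~ b = (0, b, a).
Proof. by rewrite /x1 /x2 !mulrz_triple; congr (_, _, _) => /=; lia. Qed.

Lemma mulrz_x1x0 a b : x1 *~ a + x0 *~ b = (b, a, 0).
Proof. by rewrite /x1 /x0 !mulrz_triple; congr (_, _, _) => /=; lia. Qed.

Lemma add_x0 a b c n : ((a, b, c) : monom) + x0 *~ n = (a + n, b, c).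
Proof. by rewrite /x0 !mulrz_triple; congr (_, _, _) => /=; lia. Qed.

Lemma add_x2 a b c n : ((a, b, c) : monom) + x2 *~ n = (a, b, c + n).
Proof. by rewrite /x2 !mulrz_triple; congr (_, _, _) => /=; lia. Qed.

Lemma powB12_at n j : powB K x1 x2 n (0, n - j%:Z, j%:Z) = (-1) ^+ j * gbinom K n j.
Proof.
by rewrite -mulrz_x1x2 powB_at// => i k; rewrite !mulrz_x1x2 => -[]; lia.
Qed.

Lemma powB21_at n j : powB K x2 x1 n (0, j%:Z, n - j%:Z) = (-1) ^+ j * gbinom K n j.
Proof.
by rewrite -mulrz_x2x1 powB_at// => i k; rewrite !mulrz_x2x1 => -[]; lia.
Qed.

Lemma powB10_at n j : powB K x1 x0 n (j%:Z, n - j%:Z, 0) = (-1) ^+ j * gbinom K n j.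
Proof.
by rewrite -mulrz_x1x0 powB_at// => i k; rewrite !mulrz_x1x0 => -[]; lia.
Qed.

Lemma powB12_off n p : (forall j, p <> (0, n - j%:Z, j%:Z)) -> powB K x1 x2 n p = 0.
Proof. by move=> h; apply: powB_off => j; rewrite mulrz_x1x2. Qed.

Lemma powB21_off n p : (forall j, p <> (0, j%:Z, n - j%:Z)) -> powB K x2 x1 n p = 0.
Proof. by move=> h; apply: powB_off => j; rewrite mulrz_x2x1. Qed.

Lemma powB10_off n p : (forall j, p <> (j%:Z, n - j%:Z, 0)) -> powB K x1 x0 n p = 0.
Proof. by move=> h; apply: powB_off => j; rewrite mulrz_x1x0. Qed.

(** (x1 - x2)^m contains no x0, so the exponent of x0 selects the single term m = - a - 1. The next
    two lemmas work alike. *)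
Lemma deltaB012E (s : K) a b c :
  deltaB s x0 x1 x2 (a, b, c) = s ^ (a + 1) * powB K x1 x2 (- a - 1) (0, b, c).
Proof.
rewrite (@deltaB_single _ _ _ _ _ (- a - 1)) => [|m ma]; rewrite add_x0.
  by congr (_ ^ _ * powB _ _ _ _ (_, _, _)); lia.
by apply: powB12_off => j []; lia.
Qed.

Lemma deltaB021E (s : K) a b c :
  deltaB s x0 x2 x1 (a, b, c) = s ^ (a + 1) * powB K x2 x1 (- a - 1) (0, b, c).
Proof.
rewrite (@deltaB_single _ _ _ _ _ (- a - 1)) => [|m ma]; rewrite add_x0.
  by congr (_ ^ _ * powB _ _ _ _ (_, _, _)); lia.
by apply: powB21_off => j []; lia.
Qed.

Lemma deltaB210E (s : K) a b c :
  deltaB s x2 x1 x0 (a, b, c) = s ^ (c + 1) * powB K x1 x0 (- c - 1) (a, b, 0).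
Proof.
rewrite (@deltaB_single _ _ _ _ _ (- c - 1)) => [|m ma]; rewrite add_x2.
  by congr (_ ^ _ * powB _ _ _ _ (_, _, _)); lia.
by apply: powB10_off => j []; lia.
Qed.

End PowBCoefficients.

Section Interface.
Context {K : numFieldType} {V : lmodType K}.
Variables (Y : V -> int -> V -> V) (hY : state_field Y).
Implicit Types (u v w : V) (a b c : int).

Lemma fmul_inj (f : fseries K) (g : fseries V) (p : monom) (h : nat -> monom) :
  injective h -> (forall q, (forall j, q <> h j) -> f q = 0 \/ g (p - q) = 0) ->
  fmul f g p = \sum_(j \in [set: nat]) f (h j) *: g (p - h j).
Proof.
move=> hI h0; apply: (fsbig_inj (h := h) (F :=
  fun q => f q *: g (p - q))) => // q /h0.
by case=> ->; rewrite ?scale0r ?scaler0.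
Qed.

(** The operator product contains no x0, so the delta function contributes only monomials with
    x0-exponent a; these are the terms of the expansion of (x1 - x2)^(- a - 1). *)
Lemma Jacobi_12E u v w a b c :
  fmul (deltaB 1 x0 x1 x2) (Y1Y2 Y u v w) (a, b, c) =
  mode12 Y u v w (- a - 1) (- b - 1) (- c - 1).
Proof.
rewrite (fmul_inj (h := fun j => (a, - a - 1 - j%:Z, j%:Z))).
- apply: eq_fsbigr => j _; rewrite deltaB012E powB12_at exp1rz mul1r.
  rewrite /Y1Y2 /= subrr eqxx; congr (_ *: Y _ _ (Y _ _ _)); lia.
- by move=> i j []; lia.
- move=> [[q1 q2] q3] hq; have [qa|qa] := eqVneq q1 a; [left|right].
    rewrite deltaB012E powB12_off ?mulr0// => j [q2E q3E].
    by apply: (hq j); congr (_, _, _); lia.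
  by rewrite /Y1Y2 /= subr_eq0 eq_sym (negbTE qa).
Qed.

Lemma Jacobi_21E u v w a b c :
  fmul (deltaB (-1) x0 x2 x1) (Y2Y1 Y v u w) (a, b, c) =
  mode21 Y u v w (- a - 1) (- b - 1) (- c - 1).
Proof.
rewrite (fmul_inj (h := fun j => (a, j%:Z, - a - 1 - j%:Z))).
- have z0 : eventually0 (fun i => Y v (- c - 1 + (- a - 1) - i%:Z) (Y u (- b - 1
    + i%:Z) w)).
    exact: mode12_ev0.
  rewrite /mode21 /mode12.
  rewrite (linear_bsum (f := *:%R ((-1) ^ (- a - 1)))) //; last first.
    by move=> k x y; rewrite scalerDr !scalerA mulrC.
  apply: eq_fsbigr => j _; rewrite deltaB021E powB21_at scalerA.
  congr (_ *: _).
    rewrite mulrC; congr (_ * _).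
    by rewrite -[a + 1]opprK -exprz_inv invrN1; congr (_ ^ _); lia.
  rewrite /Y2Y1 /= subrr eqxx; congr (Y _ _ (Y _ _ _)); lia.
- by move=> i j []; lia.
- move=> [[q1 q2] q3] hq; have [qa|qa] := eqVneq q1 a; [left|right].
    rewrite deltaB021E powB21_off ?mulr0// => j [q2E q3E].
    by apply: (hq j); congr (_, _, _); lia.
  by rewrite /Y2Y1 /= subr_eq0 eq_sym (negbTE qa).
Qed.

Lemma Jacobi_0E u v w a b c :
  fmul (deltaB 1 x2 x1 x0) (YY02 Y u v w) (a, b, c) =
  iter_mode Y u v w (- a - 1) (- b - 1) (- c - 1).
Proof.
rewrite (fmul_inj (h := fun j => (j%:Z, b, - b - j%:Z - 1))).
- apply: eq_fsbigr => j _; rewrite deltaB210E exp1rz mul1r.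
  have -> : (j%:Z, b, 0) = (j%:Z, - (- b - j%:Z - 1) - 1 - j%:Z, 0) :> monom.
    by congr (_, _, _); lia.
  rewrite powB10_at scalerA mulrAC -exprMn mulrNN mulr1 expr1n mul1r.
  (* The delta function yields the upper index b + j; upper negation brings it to - b - 1. *)
  rewrite -[gbinom K (- b - 1) j]gbinom_neg; congr ((_ * gbinom K _ _) *: _).
    by lia.
  rewrite /YY02 /= subrr eqxx; congr (Y (Y _ _ _) _ _); lia.
- by move=> i j []; lia.
- move=> [[q1 q2] q3] hq; have [qb|qb] := eqVneq q2 b; [left|right].
    rewrite deltaB210E powB10_off ?mulr0// => j [q2E q3E].
    by apply: (hq j); congr (_, _, _); lia.
  by rewrite /YY02 /= subr_eq0 eq_sym (negbTE qb).
Qed.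

End Interface.

(** * The hypotheses on generators in terms of modes *)

Lemma gbinom_small (K : numFieldType) (k j : nat) : (k < j)%N ->
  gbinom K k%:Z j = 0.
Proof.
move=> kj; rewrite /gbinom (bigD1 (Ordinal kj))//= subrr.
by rewrite !mul0r.
Qed.

(* For natural exponents the sum is finite, so no support condition is needed. *)
Lemma bsum_pascal_nat (K : numFieldType) (V : lmodType K) (k : nat) (g : nat -> V) :
  bsum (k%:Z + 1) g = bsum k%:Z g - bsum k%:Z (fun i => g i.+1).
Proof.
pose g' i := if (i <= k.+1)%N then g i else 0.
have gg' (n : nat) (f f' : nat -> V) : (n <= k.+1)%N ->
    (forall i, (i <= n)%N -> f i = f' i) -> bsum n%:Z f = bsum n%:Z f'.
  move=> nk ff'; apply: eq_fsbigr => i _.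
  by have [/ff' ->//|ni] := leqP i n; rewrite gbinom_small// mulr0 !scale0r.
have -> : k%:Z + 1 = k.+1%:Z by lia.
rewrite (gg' k.+1 g g') ?(gg' k g g') ?(gg' k (fun i => g i.+1) (fun i => g'
  i.+1))//.
- have -> : k.+1%:Z = k%:Z + 1 by lia.
  by apply: bsum_pascal; exists k.+2 => i ik; rewrite /g' leqNgt ik.
- by move=> i ik; rewrite /g' ltnS ik.
- by move=> i ik; rewrite /g' leqW.
- by move=> i ik; rewrite /g' ik.
Qed.

Lemma spans_ind (K : numFieldType) (V : lmodType K) (S : set V) (P : V -> Prop) :
  spans S -> P 0 -> (forall c u v, P u -> P v -> P (c *: u + v)) ->
  (forall v, S v -> P v) -> forall v, P v.
Proof.
move=> hS P0 PL PS v; have [n [c [s [sS ->]]]] := hS v.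
apply: (big_ind P) => // [x y Px Py|i _].
  by rewrite -[x]scale1r; apply: PL.
by rewrite -[_ *: _]addr0; apply: PL => //; apply: PS.
Qed.

Section Hypotheses.
Context {K : numFieldType} {V : lmodType K}.
Variables (Y : V -> int -> V -> V) (hY : state_field Y).
Implicit Types (u v w : V).

(** For a natural exponent (x1 - x2)^k is a polynomial, so its two expansions agree. This matches
    [mutually_local], which expands in x2 on both sides. *)
Lemma mode21_nat u v w (k : nat) m n : mode21 Y u v w k m n =
  bsum k%:Z (fun i => Y v (n + i%:Z) (Y u (m + k%:Z - i%:Z) w)).
Proof.
elim: k m n => [|k IH] m n.
  by rewrite mode21_0 bsum0; congr (Y _ _ (Y _ _ _)); lia.
have -> : k.+1%:Z = k%:Z + 1 by lia.
rewrite (mode21_rec hY) !IH bsum_pascal_nat; congr (_ - _); apply: eq_bsum => i.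
  by congr (Y _ _ (Y _ _ _)); lia.
by congr (Y _ _ (Y _ _ _)); lia.
Qed.

Lemma local_12E u v w (k : nat) b c :
  fmul (powB K x1 x2 k%:Z) (Y1Y2 Y u v w) (0, b, c) =
  mode12 Y u v w k (- b - 1) (- c - 1).
Proof.
rewrite (fmul_inj (h := fun j => (0, k%:Z - j%:Z, j%:Z))).
- apply: eq_fsbigr => j _; rewrite powB12_at.
  by rewrite /Y1Y2 /=; congr (_ *: Y _ _ (Y _ _ _)); lia.
- by move=> i j []; lia.
- by move=> q hq; left; apply: powB12_off.
Qed.

Lemma local_21E u v w (k : nat) b c :
  fmul (powB K x1 x2 k%:Z) (Y2Y1 Y v u w) (0, b, c) =
  mode21 Y u v w k (- b - 1) (- c - 1).
Proof.
rewrite mode21_nat (fmul_inj (h := fun j => (0, k%:Z - j%:Z, j%:Z))).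
- apply: eq_fsbigr => j _; rewrite powB12_at.
  by rewrite /Y2Y1 /=; congr (_ *: Y _ _ (Y _ _ _)); lia.
- by move=> i j []; lia.
- by move=> q hq; left; apply: powB12_off.
Qed.

Lemma mutually_local_locality u v : mutually_local Y u v ->
  exists k, locality Y k u v.
Proof.
move=> [k uv]; exists k => w; apply/funext => -[m n].
have rT := rec3B (mode12_rec hY u v w) (mode21_rec hY u v w).
have -> : mode_commutator Y u v w =
  fun x => mode12 Y u v w 0 x.1 x.2 - mode21 Y u v w 0 x.1 x.2.
  by apply/funext => x; rewrite mode12_0 mode21_0.
rewrite -(rec3_iter_l rT); have := uv w (0, - m - 1, - n - 1).
rewrite local_12E local_21E /= !opprD !opprK !addrK => ->.
by rewrite subrr.
Qed.

Lemma locality0l v : locality Y 0 0 v.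
Proof.
by move=> w; apply/funext => x;
  rewrite /= /mode_commutator !(mode0l hY) (mode0r hY) subrr.
Qed.

Lemma ex_locality_linl c u u' v : (exists k, locality Y k u v) ->
  (exists k, locality Y k u' v) ->
  exists k, locality Y k (c *: u + u') v.
Proof.
move=> [k uv] [k' uv']; exists (maxn k k'); apply: locality_linl => //.
  by apply: locality_le uv; exact: leq_maxl.
by apply: locality_le uv'; exact: leq_maxr.
Qed.

Lemma ex_locality_sym u v : (exists k, locality Y k u v) ->
  exists k, locality Y k v u.
Proof. by move=> [k /(locality_sym hY)]; exists k. Qed.

Lemma Borcherds0l v : Borcherds Y 0 v.
Proof.
move=> w l m n; rewrite /mode21 /mode12 /iter_mode !bsum_zero ?scaler0 ?subrr//
  => i.
- by rewrite !(mode0l hY) scaler0.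
- by rewrite (mode0l hY) (mode0r hY).
- by rewrite (mode0l hY).
Qed.

(** The residue picks x1^(-1), that is m = 0, so the residue formula is the input of
    [Borcherds_locality_iterate]. *)
Lemma Res_Borcherds u v : (exists k, locality Y k u v) ->
  (forall w, YY02 Y u v w =1 Res_x1 (Jacobi_lhs Y u v w)) -> Borcherds Y u v.
Proof.
move=> [k uv] it; apply: (Borcherds_locality_iterate hY uv) => w l n.
have := it w (- l - 1, 0, - n - 1).
rewrite /= /Jacobi_lhs /fsub Jacobi_12E (Jacobi_21E hY) => /esym.
by rewrite !opprD !opprK !addrK subrr.
Qed.

End Hypotheses.

(** * From generators to the whole space *)

Lemma vertex_Leibniz_of_generators (K : numFieldType) (V : lmodType K)
    (Y : V -> int -> V -> V) (U : set V) (hY : state_field Y) :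
  (forall u v : V, U u -> U v -> mutually_local Y u v) ->
  spans (mode_word Y U) ->
  (forall u v w : V, U u -> YY02 Y u v w =1 Res_x1 (Jacobi_lhs Y u v w)) ->
  vertex_Leibniz Y.
Proof.
move=> hlocal hspan hiter.
have Borcherds_gen a v : U a -> (exists k, locality Y k a v) -> Borcherds Y a v.
  by move=> Ua av; apply: (Res_Borcherds hY av) => w; exact: hiter.
(* Words are first shown local with generators only. For b_r v', the Jacobi identity for (b, v') is
   available because [b] is a generator, local with v' by induction. *)
have locality_word v : mode_word Y U v -> forall a, U a ->
  exists k, locality Y k v a.
  elim=> [u Uu a Ua|b r v' Ub _ IH a Ua];
    first exact/(mutually_local_locality hY)/hlocal.
  apply: (locality_mode hY); last exact: IH.
  - by apply: Borcherds_gen => //; apply: (ex_locality_sym hY); exact: IH.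
  - by apply: (ex_locality_sym hY); exact: IH.
  - exact/(mutually_local_locality hY)/hlocal.
have locality_gen a v : U a -> exists k, locality Y k a v.
  move=> Ua; apply: (ex_locality_sym hY); move: v.
  apply: (spans_ind hspan) => [|c u v|v /locality_word]; last exact.
  - by exists 0%N; exact: locality0l.
  - exact: ex_locality_linl.
(* Locality and the Jacobi identity are proved together, for all [v] at once: locality of the tail
   feeds [locality_mode], and its Jacobi identities feed [Borcherds_mode]. *)
have mode_word_Borcherds u : mode_word Y U u ->
  forall v, Borcherds Y u v /\ exists k, locality Y k u v.
  elim=> [{}u Uu v|a r b Ua _ IH v].
    by have [k uv] := locality_gen u v Uu; split; [apply: Borcherds_gen => //|];
      exists k.
  have ab : exists k, locality Y k (Y a r b) v.
    apply: (locality_mode hY);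
      [exact/Borcherds_gen/locality_gen|exact: locality_gen|exact: locality_gen|].
    by have [] := IH v.
  split=> //; have [k abk] := ab.
  apply: (Borcherds_mode hY) abk => z; first exact/Borcherds_gen/locality_gen.
  by have [] := IH z.
have J u v : Borcherds Y u v.
  move: u; apply: (spans_ind hspan) => [|c u u'|u uU]; first exact: Borcherds0l.
    exact: Borcherds_linl.
  by have [] := mode_word_Borcherds u uU v.
split=> // u v w [[a b] c].
by rewrite /Jacobi_lhs /fsub Jacobi_12E (Jacobi_21E hY) J -Jacobi_0E.
Qed.

Theorem theorem3p1 (R : realType) (V : lmodType R[i])
    (Y : V -> int -> V -> V) (U : set V)
    (hY : state_field Y)
    (hlocal : forall u v : V, U u -> U v -> mutually_local Y u v)
    (hspan : spans (mode_word Y U))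
    (hiter : forall u v w : V, U u ->
       YY02 Y u v w =1 Res_x1 (Jacobi_lhs Y u v w)) :
  vertex_Leibniz Y.
Proof. exact: vertex_Leibniz_of_generators hY hlocal hspan hiter. Qed.
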